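(* Let $X$ be a periodic graph with period $L=\mathbb{Z}^N$, with vertex representatives $v_0,\dots,v_n$ ($n\ge 1$) of $V/L$ and weights $w_{ij\gamma}$, let $\hat X$ be obtained from $X$ by contracting $v_0$ and $v_1$ to $\hat v$, and fix a period homomorphism $\rho\colon L\to\mathbb{R}^N$. Fix all weights of $X$ except $w_{010}=w_{100}$, which varies over the non-negative real values for which $X$ is connected. Let $\Phi^{(h)}$ (depending on $w_{010}$) and $\hat\Phi^{(h)}$ be the harmonic realizations of $X$ and $\hat X$ with period homomorphism $\rho$, normalized by $\Phi^{(h)}(v_0)=\hat\Phi^{(h)}(\hat v)=0$. Then $\Phi^{(h)}$ converges to $\hat\Phi^{(h)}$ as $w_{010}\to\infty$; that is, $\Phi^{(h)}(v_i)\to\hat\Phi^{(h)}(v_i)$ for each $2\le i\le n$, and $\Phi^{(h)}(v_1)\to\hat\Phi^{(h)}(\hat v)=0$. In particular $\lim_{w_{010}\to\infty}\Phi^{(h)}(e_{010})=0$. Consequently, \[ \lim_{w_{010}\to\infty}\mathcal{T}(X,\Phi^{(h)})=\mathcal{T}(\hat X,\hat\Phi^{(h)}) \quad\text{and}\quad \lim_{w_{010}\to\infty}\mathcal{E}(X,\Phi^{(h)})=\mathcal{E}(\hat X,\hat\Phi^{(h)}). \]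
   Context: A weighted graph $X=(V,E,w)$ has a vertex set $V$, a set $E$ of oriented edges, maps $o,t\colon E\to V$ (origin, terminal) and $\iota\colon E\to E$ (orientation reversal) with $\iota^2=\mathrm{id}$, $\iota(e)\ne e$, $o(\iota(e))=t(e)$, and a weight function $w\colon E\to\mathbb{R}_{\ge0}$ with $w\circ\iota=w$. Loops and multiple edges are allowed; parallel edges may be merged by adding their weights. $X$ is connected if the 1-complex formed by all vertices and the positive-weight edges is connected. A periodic graph is an infinite connected weighted graph with an action of $L=\mathbb{Z}^N$ ($N\ge1$) by weight-preserving automorphisms such that $X\to X/L$ is a covering and $X/L=(V/L,E/L)$ is finite. A periodic realization of $X$ is a map $\Phi\colon V\to\mathbb{R}^N$ together with an injective homomorphism $\rho\colon L\to\mathbb{R}^N$ (the period homomorphism) whose image is a lattice in $\mathbb{R}^N$, with $\Phi(\gamma v)=\Phi(v)+\rho(\gamma)$ for all $v\in V$, $\gamma\in L$. For an edge $e$, $\Phi(e):=\Phi(t(e))-\Phi(o(e))$, which descends to $E/L$. The energy is $\mathcal{E}(X,\Phi)=\frac12\sum_{e\in E/L}w(e)\|\Phi(e)\|^2$ and the global tension tensor is $\mathcal{T}(X,\Phi)=\frac12\sum_{e\in E/L}w(e)\Phi(e)\Phi(e)^{\mathsf T}$. $\Phi$ is harmonic if it minimizes $\mathcal{E}$ among periodic realizations with the same $\rho$; equivalently $\sum_{o(e)=v}w(e)\Phi(e)=0$ for all $v\in V$. (A harmonic realization with given $\rho$ is unique up to translation.) Notation: $v_0,\dots,v_n\in V$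 are representatives of $V/L$; $e_{ij\gamma}$ is the edge from $v_i$ to $\gamma v_j$ ($\gamma\in L$), of weight $w_{ij\gamma}\ge0$ (zero for all but finitely many $(i,j,\gamma)$; $w_{ij,-\gamma}=w_{ji\gamma}$); these edges represent $E/L$. Thus $e_{010}$ joins $v_0$ to $v_1$, and $w_{010}=w_{100}$ is treated as a single variable. Contraction of $v_0$ and $v_1$ to $\hat v$: the periodic graph $\hat X$ with the same edges, weights and $L$-action, in which for every $\gamma\in L$ the vertices $\gamma v_0$ and $\gamma v_1$ are identified to a single vertex $\gamma\hat v$ (so $e_{010}$ becomes a loop, with realization vector $0$). *)

(* Defs.v *)
From HB Require Import structures.
From Stdlib Require Import Relations.
From mathcomp Require Import all_boot all_order all_algebra generic_quotient.
From mathcomp Require Import all_classical all_reals all_analysis.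

Set Implicit Arguments.
Unset Strict Implicit.
Unset Printing Implicit Defensive.
Import Order.TTheory GRing.Theory Num.Theory.
Import numFieldNormedType.Exports.

Local Open Scope classical_set_scope.
Local Open Scope ring_scope.
Local Open Scope quotient_scope.

Notation lattice_group N := ('rV[int]_N).

(* The quotient by the equivalence relation generated by [r]. *)
Section GeneratedQuotient.
Variables (T : choiceType) (r : T -> T -> Prop).

Definition gen_rel (x y : T) : bool := `[< clos_refl_sym_trans T r x y >].

Lemma gen_rel_refl : reflexive gen_rel.
Proof. by move=> x; apply/asboolP; apply: rst_refl. Qed.

Lemma gen_rel_sym : symmetric gen_rel.
Proof. by move=> x y; apply/asboolP/asboolP => h; apply: rst_sym. Qed.

Lemma gen_rel_trans : transitive gen_rel.
Proof.
move=> y x z /asboolP xy /asboolP yz; apply/asboolP.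
exact: rst_trans xy yz.
Qed.

Canonical gen_equiv := EquivRel gen_rel gen_rel_refl gen_rel_sym gen_rel_trans.

Definition gen_quot := {eq_quot gen_equiv}.

Lemma gen_quotP (x y : T) :
  \pi_gen_quot x = \pi_gen_quot y <-> clos_refl_sym_trans T r x y.
Proof.
split=> [/eqmodP|] h; first exact/asboolP.
by apply/eqmodP; apply/asboolP.
Qed.

End GeneratedQuotient.

Record zaction (N : nat) (T : Type) := ZAction {
  zact :> lattice_group N -> T -> T;
  zact0 : forall x, zact 0 x = x;
  zactD : forall g h x, zact (g + h) x = zact g (zact h x)
}.

Definition orbit_rel (N : nat) (T : Type) (a : zaction N T) (x y : T) : Prop :=
  exists g, y = a g x.

Definition orbits (N : nat) (T : choiceType) (a : zaction N T) :=
  gen_quot (orbit_rel a).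

(* A graph with an action of Z^N by automorphisms.  Weights are kept separate,
   so that they can vary on a fixed graph. *)
Record zgraph (N : nat) := ZGraph {
  vert : choiceType;
  edge : choiceType;
  orig : edge -> vert;
  term : edge -> vert;
  erev : edge -> edge;
  vact : zaction N vert;
  eact : zaction N edge;
  erevK : involutive erev;
  erev_neq : forall e, erev e <> e;
  orig_rev : forall e, orig (erev e) = term e;
  orig_act : forall g e, orig (eact g e) = vact g (orig e);
  erev_act : forall g e, erev (eact g e) = eact g (erev e)
}.

Section PeriodicGraphs.
Variables (R : realType) (N : nat) (G : zgraph N).
Implicit Types (w : edge G -> R) (Phi : vert G -> 'cV[R]_N).

Definition is_weight w : Prop :=
  [/\ forall e, 0 <= w e,
      forall e, w (erev e) = w e
    & forall g e, w (eact G g e) = w e].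

Definition connected_graph w : Prop :=
  forall x y : vert G,
    clos_refl_trans (vert G)
      (fun a b => exists e : edge G, [/\ orig e = a, term e = b & 0 < w e]) x y.

(* The quotient map is a covering with deck transformation group Z^N: it is
   bijective on stars, and Z^N acts freely. *)
Definition quotient_is_covering : Prop :=
  (forall x : vert G,
     set_bij [set e : edge G | orig e = x]
             [set c : orbits (eact G) |
                \pi_(orbits (vact G)) (orig (repr c)) =
                \pi_(orbits (vact G)) x]
             (fun e => \pi_(orbits (eact G)) e)) /\
  (forall g (x : vert G), vact G g x = x -> g = 0).

Definition is_periodic_graph w : Prop :=
  [/\ is_weight w,
      connected_graph w,
      infinite_set [set: vert G],
      quotient_is_covering
    & finite_set [set: orbits (vact G)] /\ finite_set [set: orbits (eact G)]].

Definition is_lattice (A : set 'cV[R]_N) : Prop :=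
  exists2 B : 'M[R]_N, B \in unitmx
    & A = [set B *m map_mx intr z | z in [set: 'cV[int]_N]].

Definition is_period_hom (rho : {additive lattice_group N -> 'cV[R]_N}) : Prop :=
  injective rho /\ is_lattice (range rho).

Definition is_realization (rho : {additive lattice_group N -> 'cV[R]_N}) Phi :
    Prop :=
  is_period_hom rho /\ forall g x, Phi (vact G g x) = Phi x + rho g.

Definition edge_vec Phi (e : edge G) : 'cV[R]_N := Phi (term e) - Phi (orig e).

Definition sqnorm (x : 'cV[R]_N) : R := \sum_(i < N) x i 0 ^+ 2.

(* The summands of the next two definitions do not depend on the representative
   [repr c] of the edge orbit [c], since [w] is invariant and [edge_vec Phi]
   descends to the orbits. *)
Definition energy w Phi : R :=
  2^-1 * \sum_(c \in [set: orbits (eact G)])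
           (w (repr c) * sqnorm (edge_vec Phi (repr c))).

Definition tension w Phi : 'M[R]_N :=
  2^-1 *: \sum_(c \in [set: orbits (eact G)])
            (w (repr c) *: (edge_vec Phi (repr c) *m (edge_vec Phi (repr c))^T)).

Definition is_harmonic w (rho : {additive lattice_group N -> 'cV[R]_N}) Phi :
    Prop :=
  is_realization rho Phi /\
  forall Psi, is_realization rho Psi -> energy w Phi <= energy w Psi.

(* The weight function obtained from [w] by giving the weight [s] to the edge
   [e0], hence also to its reversal and to their translates. *)
Definition reweight w (e0 : edge G) (s : R) (e : edge G) : R :=
  if `[< exists g, e = eact G g e0 \/ e = eact G g (erev e0) >] then s
  else w e.

End PeriodicGraphs.

Section Contraction.
Variables (N : nat) (G : zgraph N) (a b : vert G).

Definition identify (x y : vert G) : Prop :=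
  exists g, x = vact G g a /\ y = vact G g b.

Definition contract_vert := gen_quot identify.

Definition contract_pi (x : vert G) : contract_vert := \pi_contract_vert x.

Definition contract_vact_fun (g : lattice_group N) (q : contract_vert) :
    contract_vert :=
  contract_pi (vact G g (repr q)).

Lemma identify_act g x y :
  clos_refl_sym_trans _ identify x y ->
  clos_refl_sym_trans _ identify (vact G g x) (vact G g y).
Proof.
elim=> [u v [h [uE vE]]|u|u v _ IH|u v t _ IH1 _ IH2].
- by apply: rst_step; exists (g + h); rewrite uE vE !zactD.
- exact: rst_refl.
- exact: rst_sym.
- exact: rst_trans IH1 IH2.
Qed.

Lemma contract_vact_pi g x :
  contract_vact_fun g (contract_pi x) = contract_pi (vact G g x).
Proof.
by apply/gen_quotP/identify_act/gen_quotP; rewrite reprK.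
Qed.

Lemma contract_vact0 q : contract_vact_fun 0 q = q.
Proof. by rewrite /contract_vact_fun zact0 /contract_pi reprK. Qed.

Lemma contract_vactD g h q :
  contract_vact_fun (g + h) q = contract_vact_fun g (contract_vact_fun h q).
Proof. by rewrite {3}/contract_vact_fun contract_vact_pi -zactD. Qed.

Definition contract_vact : zaction N contract_vert :=
  ZAction contract_vact0 contract_vactD.

Lemma contract_orig_rev (e : edge G) :
  contract_pi (orig (erev e)) = contract_pi (term e).
Proof. by rewrite orig_rev. Qed.

Lemma contract_orig_act g (e : edge G) :
  contract_pi (orig (eact G g e)) = contract_vact g (contract_pi (orig e)).
Proof. by rewrite /= contract_vact_pi orig_act. Qed.

(* For all g, the vertices [g a] and [g b] are identified; edges, reversal and
   the action on edges are unchanged, so that a weight function on [edge G] is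
   also one on [edge contract_graph]. *)
Definition contract_graph : zgraph N :=
  @ZGraph N contract_vert (edge G)
    (fun e => contract_pi (orig e)) (fun e => contract_pi (term e))
    (@erev N G) contract_vact (eact G)
    (@erevK N G) (@erev_neq N G) contract_orig_rev contract_orig_act
    (@erev_act N G).

End Contraction.

(* Main.v *)
Require Import Defs.
From Stdlib Require Import Relations.
From mathcomp Require Import all_boot all_order all_algebra generic_quotient.
From mathcomp Require Import all_classical all_reals all_analysis.
From mathcomp Require Import ring lra.

Set Implicit Arguments.
Unset Strict Implicit.
Unset Printing Implicit Defensive.
Import Order.TTheory GRing.Theory Num.Theory.
Import numFieldNormedType.Exports.

Local Open Scope classical_set_scope.
Local Open Scope ring_scope.

(** Let M be the energy of the harmonic realization of the contraction, pulled
    back to a realization Psi of X, and m(s) the energy of Phi(s) for the weight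
    s on e010.  Minimality of Phi(s) gives m(s) <= M, so s |Phi(s)(e010)|^2 is
    bounded.  Translating the orbit of v_1 by -Phi(s)(e010) gives a realization
    which descends to the contraction, whence M - m(s) = O(s^(-1/2)).  By the
    parallelogram identity, the energy of Phi(s) - Psi for the weight s is at
    most 2 (M - m(s)), since the midpoint has energy at least m(s).  Hence every
    edge vector of Phi(s) of positive weight converges, and so, along paths from
    v_0, does every vertex; moreover s |Phi(s)(e010)|^2 tends to 0, so that
    e010 contributes nothing to the limit of the tension. *)

(** * Inequalities for the squared Euclidean norm *)

Section SquareNorm.
Variables (R : realType) (N : nat).
Implicit Types x y : 'cV[R]_N.

Lemma sqnorm_ge0 x : 0 <= sqnorm x.
Proof. by apply: sumr_ge0 => i _; exact: sqr_ge0. Qed.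

Lemma sqnormZ (k : R) x : sqnorm (k *: x) = k ^+ 2 * sqnorm x.
Proof.
by rewrite /sqnorm mulr_sumr; apply: eq_bigr => i _; rewrite !mxE exprMn.
Qed.

Lemma sqnorm0 : sqnorm (0 : 'cV[R]_N) = 0.
Proof. by rewrite -(scale0r 0) sqnormZ expr0n mul0r. Qed.

Lemma sqnormN x : sqnorm (- x) = sqnorm x.
Proof. by rewrite -scaleN1r sqnormZ sqrrN expr1n mul1r. Qed.

Lemma sqnorm_parallelogram x y :
  sqnorm (x - y) =
  2 * sqnorm x + 2 * sqnorm y - 4 * sqnorm (2^-1 *: (x + y)).
Proof.
rewrite /sqnorm !mulr_sumr -big_split -sumrB /=.
by apply: eq_bigr => i _; rewrite !mxE; field.
Qed.

(** Young's inequality: coordinatewise the two sides differ by [t^-1 * (t * a + b) ^+ 2]. The free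
    parameter [t] lets the factor of [sqnorm x] be brought close to 1. *)
Lemma sqnormB_le (t : R) x y : 0 < t ->
  sqnorm (x - y) <= (1 + t) * sqnorm x + (1 + t^-1) * sqnorm y.
Proof.
move=> t0; rewrite /sqnorm !mulr_sumr -big_split /=.
apply: ler_sum => i _; rewrite !mxE -subr_ge0.
set a := x i 0; set b := y i 0.
have -> : (1 + t) * a ^+ 2 + (1 + t^-1) * b ^+ 2 - (a - b) ^+ 2
   = t^-1 * (t * a + b) ^+ 2 by field; rewrite gt_eqF.
by rewrite mulr_ge0 ?sqr_ge0// invr_ge0 ltW.
Qed.

(** Both squares are at most [sqnorm x], also for i = j, so their mean, which dominates the product,
    is too. *)
Lemma normM_le_sqnorm x i j : `|x i 0 * x j 0| <= sqnorm x.
Proof.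
have le1 k : x k 0 ^+ 2 <= sqnorm x.
  rewrite /sqnorm (bigD1 k) //= lerDl.
  by apply: sumr_ge0 => l _; exact: sqr_ge0.
have := le1 i; have := le1 j; rewrite normrM.
rewrite -(real_normK (num_real (x i 0))) -(real_normK (num_real (x j 0))).
have := sqr_ge0 (`|x i 0| - `|x j 0|); nra.
Qed.

End SquareNorm.

(** * Limits of matrices, coordinates and finite sums *)

Lemma cvg_mx (R : realType) (T : Type) (F : set_system T) (FF : Filter F)
    (m n : nat) (f : T -> 'M[R]_(m, n)) (l : 'M[R]_(m, n)) :
  (forall i j, f t i j @[t --> F] --> l i j) -> f t @[t --> F] --> l.
Proof.
move=> h; apply/cvg_ballP => e e0.
have : \forall t \near F, forall i j, ball (l i j) e (f t i j).
  apply: filter_forall => i; apply: filter_forall => j.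
  by have /cvg_ballP := h i j; exact.
by apply: filterS => t ht; split.
Qed.

Lemma sqnorm_cvg_coord (R : realType) (T : Type) (F : set_system T)
    (FF : Filter F) (N : nat) (f : T -> 'cV[R]_N) (l : 'cV[R]_N) :
  sqnorm (f t - l) @[t --> F] --> (0 : R) ->
  forall i, f t i 0 @[t --> F] --> l i 0.
Proof.
move=> h i; apply/cvgrPdist_lt => e e0.
have e20 : 0 < e ^+ 2 by rewrite exprn_gt0.
move/cvgrPdist_lt : h => /(_ _ e20); apply: filterS => t.
rewrite sub0r normrN ger0_norm ?sqnorm_ge0// => ht.
rewrite -(@ltr_pXn2r _ 2)// ?nnegrE ?(ltW e0)// distrC.
apply: le_lt_trans ht.
by have := normM_le_sqnorm (f t - l) i i; rewrite normrM -expr2 !mxE.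
Qed.

Lemma cvg_sum_seq (R : realType) (T I : Type) (F : set_system T)
    (FF : Filter F) (r : seq I) (f : I -> T -> R) (l : I -> R) :
  (forall i, f i t @[t --> F] --> l i) ->
  \sum_(i <- r) f i t @[t --> F] --> \sum_(i <- r) l i.
Proof.
move=> h; elim: r => [|i r IH].
  by under eq_fun do rewrite big_nil; rewrite big_nil; exact: cvg_cst.
under eq_fun do rewrite big_cons; rewrite big_cons.
exact: cvgD.
Qed.

Lemma cvg_sqrt_inv (R : realType) :
  Num.sqrt (s^-1 : R) @[s --> +oo] --> (0 : R).
Proof.
rewrite -[X in _ --> X]sqrtr0; apply: (@cvg_comp _ _ _ (fun s : R => s^-1)).
  2: exact: sqrt_continuous.
apply/gtr0_cvgV0; first exact: nbhs_pinfty_gt.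
exact: cvg_id.
Qed.

(** * Edge vectors, edge orbits and change of weight *)

Section QuasiPeriodic.
Variables (R : realType) (N : nat) (G : zgraph N).
Implicit Types (w : edge G -> R) (Phi Psi : vert G -> 'cV[R]_N).
Implicit Types (tau : lattice_group N -> 'cV[R]_N).

Lemma zactK (T : Type) (a : zaction N T) g x : a (- g) (a g x) = x.
Proof. by rewrite -zactD addNr zact0. Qed.

Lemma term_act g (e : edge G) : term (eact G g e) = vact G g (term e).
Proof. by rewrite -!orig_rev -orig_act erev_act. Qed.

Lemma orbit_relP (T : Type) (a : zaction N T) x y :
  clos_refl_sym_trans T (orbit_rel a) x y -> orbit_rel a x y.
Proof.
elim=> [//|u|u v _ [g ->]|u v t _ [g ->] _ [h ->]].
- by exists 0; rewrite zact0.
- by exists (- g); rewrite zactK.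
- by exists (h + g); rewrite zactD.
Qed.

Lemma orbits_eqP (T : choiceType) (a : zaction N T) x y :
  (\pi_(orbits a) x = \pi_(orbits a) y)%qT <-> exists g, y = a g x.
Proof.
split=> h; first by apply: orbit_relP; apply/gen_quotP.
by apply/gen_quotP; apply: rst_step.
Qed.

Lemma repr_orbit (T : choiceType) (a : zaction N T) x :
  exists g, repr (\pi_(orbits a) x)%qT = a g x.
Proof. by apply/orbits_eqP; rewrite reprK. Qed.

(** The function [tau] is arbitrary, so that differences of two realizations are included; this
    suffices for edge vectors to descend to edge orbits. *)
Definition quasiperiodic Phi :=
  exists tau, forall g x, Phi (vact G g x) = Phi x + tau g.

Lemma edge_vec_act Phi : quasiperiodic Phi ->
  forall g e, edge_vec Phi (eact G g e) = edge_vec Phi e.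
Proof.
move=> [tau h] g e; rewrite /edge_vec term_act orig_act !h.
by rewrite opprD addrACA subrr addr0.
Qed.

Lemma edge_vec_rev Phi e : edge_vec Phi (erev e) = - edge_vec Phi e.
Proof. by rewrite /edge_vec orig_rev -[term _]orig_rev erevK opprB. Qed.

Lemma quasiperiodicB Phi Psi : quasiperiodic Phi -> quasiperiodic Psi ->
  quasiperiodic (fun x => Phi x - Psi x).
Proof.
move=> [t ht] [u hu]; exists (fun g => t g - u g) => g x.
by rewrite ht hu opprD addrACA.
Qed.

Lemma edge_vecB Phi Psi e :
  edge_vec (fun x => Phi x - Psi x) e = edge_vec Phi e - edge_vec Psi e.
Proof. by rewrite /edge_vec !opprB addrACA [RHS]addrACA [- Psi _ - _]addrC. Qed.

(** The condition tested by [reweight]. It admits reversals, hence the sign in [edge_vec_same]. *)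
Definition same_edge (e0 e : edge G) : Prop :=
  exists g, e = eact G g e0 \/ e = eact G g (erev e0).

Lemma same_edge_act e0 g e : same_edge e0 (eact G g e) <-> same_edge e0 e.
Proof.
split=> [[h hh]|[h hh]].
- exists (- g + h); rewrite !zactD.
  by case: hh => <-; [left|right]; rewrite zactK.
- by exists (g + h); rewrite !zactD; case: hh => ->; [left|right].
Qed.

Lemma same_edge_refl e : same_edge e e.
Proof. by exists 0; left; rewrite zact0. Qed.

Lemma edge_vec_same Phi e0 e : quasiperiodic Phi -> same_edge e0 e ->
  edge_vec Phi e = edge_vec Phi e0 \/ edge_vec Phi e = - edge_vec Phi e0.
Proof.
move=> hp [g [] ->]; rewrite edge_vec_act//; [by left|right].
exact: edge_vec_rev.
Qed.

Lemma reweight_same w e0 s e : same_edge e0 e -> reweight w e0 s e = s.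
Proof. by move=> h; rewrite /reweight asboolT. Qed.

Lemma reweight_other w e0 s e : ~ same_edge e0 e -> reweight w e0 s e = w e.
Proof. by move=> h; rewrite /reweight asboolF. Qed.

Lemma reweight_act w e0 s : (forall g e, w (eact G g e) = w e) ->
  forall g e, reweight w e0 s (eact G g e) = reweight w e0 s e.
Proof.
move=> h g e; have [se|se] := pselect (same_edge e0 e).
  by rewrite !reweight_same//; apply/same_edge_act.
by rewrite !reweight_other// => /same_edge_act.
Qed.

Lemma reweight_ge0 w e0 s : 0 <= s -> (forall e, 0 <= w e) ->
  forall e, 0 <= reweight w e0 s e.
Proof. by move=> s0 w0 e; rewrite /reweight; case: ifP. Qed.

Lemma connected_reweight w e0 s : 0 < s -> connected_graph w ->
  connected_graph (reweight w e0 s).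
Proof.
move=> s0 hw x y; elim: (hw x y) => [a b [e [oe te we]]|a|a b c _ h1 _ h2].
- apply: rt_step; exists e; split=> //.
  by rewrite /reweight; case: ifP.
- exact: rt_refl.
- exact: rt_trans h1 h2.
Qed.

End QuasiPeriodic.

(** * The energy as a quadratic form, and the limit of the tension *)

Section Energy.
Variables (R : realType) (N : nat) (G : zgraph N).
Hypothesis fin : finite_set [set: orbits (eact G)].
Implicit Types (w : edge G -> R) (Phi Psi : vert G -> 'cV[R]_N).

Let cells : seq (orbits (eact G)) :=
  finmap.enum_fset (fset_set [set: orbits (eact G)]).

Lemma energyE w Phi : energy w Phi =
  2^-1 * \sum_(c <- cells) (w (repr c) * sqnorm (edge_vec Phi (repr c))).
Proof. by rewrite /energy fsbig_finite. Qed.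

Lemma tensionE w Phi i j : tension w Phi i j =
  2^-1 * \sum_(c <- cells) (w (repr c) *
     (edge_vec Phi (repr c) i 0 * edge_vec Phi (repr c) j 0)).
Proof.
rewrite /tension fsbig_finite// mxE summxE; congr (_ * _).
by apply: eq_bigr => c _; rewrite !mxE big_ord1 !mxE.
Qed.

Lemma ler_energy w w' Phi Psi :
  (forall e, w e * sqnorm (edge_vec Phi e) <= w' e * sqnorm (edge_vec Psi e)) ->
  energy w Phi <= energy w' Psi.
Proof.
move=> h; rewrite !energyE ler_pM2l ?invr_gt0//.
by apply: ler_sum => c _; exact: h.
Qed.

Lemma eq_energy w w' Phi Psi :
  (forall e, w e * sqnorm (edge_vec Phi e) = w' e * sqnorm (edge_vec Psi e)) ->
  energy w Phi = energy w' Psi.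
Proof. by move=> h; apply/eqP; rewrite eq_le !ler_energy// => e; rewrite h. Qed.

Lemma energy_ge0 w Phi : (forall e, 0 <= w e) -> 0 <= energy w Phi.
Proof.
move=> h; rewrite energyE mulr_ge0 ?invr_ge0//.
by apply: sumr_ge0 => c _; rewrite mulr_ge0 ?sqnorm_ge0.
Qed.

(** All terms of the energy are non-negative, so it is at least the term of the orbit of [e]; the
    factor 2 cancels the 1/2. *)
Lemma edge_le_energy w Phi e : (forall e, 0 <= w e) ->
  (forall g e, w (eact G g e) = w e) -> quasiperiodic Phi ->
  w e * sqnorm (edge_vec Phi e) <= 2 * energy w Phi.
Proof.
move=> w0 wi hp; rewrite energyE mulrA mulfV ?pnatr_eq0// mul1r.
have [g ge] := repr_orbit (eact G) e.
rewrite (bigD1_seq (\pi_(orbits (eact G)) e)%qT) ?finmap.fset_uniq//=;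
  last first.
  by rewrite (in_fset_set fin) inE.
rewrite ge wi edge_vec_act// lerDl.
by apply: sumr_ge0 => c _; rewrite mulr_ge0 ?sqnorm_ge0.
Qed.

Lemma energy_parallelogram w Phi Psi :
  energy w (fun x => Phi x - Psi x) =
  2 * energy w Phi + 2 * energy w Psi
  - 4 * energy w (fun x => 2^-1 *: (Phi x + Psi x)).
Proof.
rewrite !energyE ![_ * (2^-1 * _)]mulrCA -mulrDr -mulrBr; congr (_ * _).
rewrite !mulr_sumr -big_split -sumrB /=; apply: eq_bigr => c _.
rewrite edge_vecB sqnorm_parallelogram.
have -> : edge_vec (fun x => 2^-1 *: (Phi x + Psi x)) (repr c)
   = 2^-1 *: (edge_vec Phi (repr c) + edge_vec Psi (repr c)).
  by rewrite /edge_vec -scalerBr opprD addrACA.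
by ring.
Qed.

Lemma energyB_le w Phi Psi (t : R) : (forall e, 0 <= w e) -> 0 < t ->
  energy w (fun x => Phi x - Psi x) <=
  (1 + t) * energy w Phi + (1 + t^-1) * energy w Psi.
Proof.
move=> w0 t0; rewrite !energyE ![_ * (2^-1 * _)]mulrCA -mulrDr.
rewrite ler_pM2l ?invr_gt0// !mulr_sumr -big_split /=.
apply: ler_sum => c _; rewrite edge_vecB.
apply: le_trans (ler_wpM2l (w0 _) (sqnormB_le _ _ t0)) _.
by rewrite mulrDr !(mulrCA (w _)).
Qed.

(** The factor after [sqnorm d] is the Dirichlet energy of the scalar function [chi], which does not
    depend on [d]. *)
Lemma energyZ w (chi : vert G -> R) (d : 'cV[R]_N) :
  energy w (fun x => chi x *: d) =
  sqnorm d * (2^-1 * \sum_(c <- cells)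
     (w (repr c) * (chi (term (repr c)) - chi (orig (repr c))) ^+ 2)).
Proof.
rewrite energyE mulrCA; congr (_ * _); rewrite mulr_sumr; apply: eq_bigr => c _.
by rewrite /edge_vec -scalerBl sqnormZ; ring.
Qed.

Lemma energy_reweight_null w e0 s Phi : quasiperiodic Phi ->
  edge_vec Phi e0 = 0 -> energy (reweight w e0 s) Phi = energy w Phi.
Proof.
move=> hp h0; apply: eq_energy => e; have [se|se] := pselect (same_edge e0 e).
  by case: (edge_vec_same hp se) => ->; rewrite h0 ?oppr0 sqnorm0 !mulr0.
by rewrite reweight_other.
Qed.

(** Off the orbit of [e0] and its reversal the weights are constant and the edge vectors converge.
    On it the weight s is unbounded, but the entries are dominated by s |Phi(s)(e0)|^2. *)
Lemma cvg_tension w e0 (Phi : R -> vert G -> 'cV[R]_N) Psi :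
  (forall s, 0 < s -> quasiperiodic (Phi s)) -> quasiperiodic Psi ->
  edge_vec Psi e0 = 0 ->
  (forall x i, Phi s x i 0 @[s --> +oo] --> Psi x i 0) ->
  s * sqnorm (edge_vec (Phi s) e0) @[s --> +oo] --> (0 : R) ->
  tension (reweight w e0 s) (Phi s) @[s --> +oo] --> tension w Psi.
Proof.
move=> hP hQ h0 hc hs; apply: cvg_mx => i j.
under eq_fun do rewrite tensionE.
rewrite tensionE; apply: cvgMr; apply: cvg_sum_seq => c.
have [se|se] := pselect (same_edge e0 (repr c)); last first.
  under eq_fun do rewrite reweight_other//.
  apply: cvgMr; apply: cvgM; rewrite /edge_vec.
    by under eq_fun do rewrite !mxE; rewrite !mxE; apply: cvgB.
  by under eq_fun do rewrite !mxE; rewrite !mxE; apply: cvgB.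
have -> : edge_vec Psi (repr c) = 0.
  by case: (edge_vec_same hQ se) => ->; rewrite h0 ?oppr0.
rewrite !mxE !mulr0; apply/norm_cvg0P.
apply: (squeeze_cvgr _ (cvg_cst 0) hs).
near=> s; have s0 : 0 < s by [].
rewrite normr_ge0 /= reweight_same// normrM gtr0_norm// ler_pM2l//.
apply: le_trans (normM_le_sqnorm _ _ _) _.
by case: (edge_vec_same (hP s s0) se) => ->; rewrite ?sqnormN.
Unshelve. all: by end_near. Qed.

End Energy.

(** * Passage to the contraction and the energy gap *)

Section Contracted.
Variables (R : realType) (N : nat) (G : zgraph N) (a b : vert G).
Variable rho : {additive lattice_group N -> 'cV[R]_N}.
Implicit Types (w : edge G -> R) (Phi Psi : vert G -> 'cV[R]_N).
Implicit Type Phihat : vert (contract_graph a b) -> 'cV[R]_N.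

Lemma realization_quasiperiodic Phi : is_realization rho Phi ->
  quasiperiodic Phi.
Proof. by move=> [_ h]; exists rho. Qed.

Lemma realization_contract Phihat :
  is_realization (G := contract_graph a b) rho Phihat ->
  is_realization rho (fun x => Phihat (contract_pi a b x)).
Proof.
by move=> [hr h]; split=> // g x; rewrite -h /= contract_vact_pi.
Qed.

Lemma contract_pi_ab : contract_pi a b a = contract_pi a b b.
Proof. by apply/gen_quotP/rst_step; exists 0; rewrite !zact0. Qed.

(** The relation [identify] only links g a to g b, where equivariance makes [Phi] agree; so [Phi] is
    constant on classes and may be read off at [repr]. *)
Lemma realization_descend Phi : is_realization rho Phi -> Phi a = Phi b ->
  exists2 Phihat, is_realization (G := contract_graph a b) rho Phihat
    & forall x, Phihat (contract_pi a b x) = Phi x.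
Proof.
move=> [hr h] hab; pose F := fun q : contract_vert a b => Phi (repr q).
have eqPhi x y : clos_refl_sym_trans _ (identify a b) x y -> Phi x = Phi y.
  elim=> [u v [g [-> ->]]|//|u v _ <-//|u v t _ -> _ -> //].
  by rewrite !h hab.
have FE x : F (contract_pi a b x) = Phi x.
  by apply/eqPhi/gen_quotP; rewrite reprK.
exists F => //; split=> // g q.
by rewrite -[q in LHS]reprK /= contract_vact_pi FE h.
Qed.

(** [Psi] descends to a competitor of the same energy, since both graphs have the same edge
    orbits. *)
Lemma harmonic_contract_le w Phihat Psi :
  is_harmonic (G := contract_graph a b) w rho Phihat ->
  is_realization rho Psi -> Psi a = Psi b ->
  energy (G := contract_graph a b) w Phihat <= energy w Psi.
Proof.
move=> [_ hmin] hPsi hab.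
have [Psihat hr hE] := realization_descend hPsi hab.
apply: le_trans (hmin _ hr) _; rewrite le_eqVlt; apply/orP; left; apply/eqP.
by congr (_ * _); apply: eq_fsbigr => c _; rewrite /edge_vec !hE.
Qed.

Section Stiff.
Variables (w : edge G -> R) (e0 : edge G).
Variable Phihat : vert (contract_graph a b) -> 'cV[R]_N.
Hypotheses (hw : is_weight w) (fin : finite_set [set: orbits (eact G)]).
Hypotheses (orig_e0 : orig e0 = a) (term_e0 : term e0 = b).
Hypothesis hPhihat : is_harmonic (G := contract_graph a b) w rho Phihat.

Let Psi x := Phihat (contract_pi a b x).
Let hPsi : is_realization rho Psi := realization_contract hPhihat.1.

Lemma contract_edge_vec : edge_vec Psi e0 = 0.
Proof. by rewrite /edge_vec orig_e0 term_e0 /Psi contract_pi_ab subrr. Qed.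

Lemma energy_contract s :
  energy (reweight w e0 s) Psi = energy (G := contract_graph a b) w Phihat.
Proof.
by apply: (energy_reweight_null fin _ _ (realization_quasiperiodic hPsi));
  exact: contract_edge_vec.
Qed.

Lemma harmonic_energy_le s Phi : is_harmonic (reweight w e0 s) rho Phi ->
  energy (reweight w e0 s) Phi <= energy (G := contract_graph a b) w Phihat.
Proof. by move=> [_ /(_ _ hPsi)]; rewrite energy_contract. Qed.

Lemma energy_diff_le s Phi : is_harmonic (reweight w e0 s) rho Phi ->
  energy (reweight w e0 s) (fun x => Phi x - Psi x) <=
  2 * (energy (G := contract_graph a b) w Phihat
       - energy (reweight w e0 s) Phi).
Proof.
move=> [hPhi hmin]; rewrite energy_parallelogram// energy_contract.
have : energy (reweight w e0 s) Phi <=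
       energy (reweight w e0 s) (fun x => 2^-1 *: (Phi x + Psi x)).
  (* The midpoint again has period homomorphism [rho], so it competes with [Phi]. *)
  apply: hmin; split=> [|g x]; first exact: hPhi.1.
  rewrite hPhi.2 hPsi.2 addrACA scalerDr; congr (_ + _).
  by apply/matrixP => i j; rewrite !mxE; field.
by lra.
Qed.

Hypothesis ab : ~ exists g, b = vact G g a.

(* Moving the orbit of b by -Phi(e0) turns Phi into a map which descends to the
   contraction; its energy exceeds that of Phi only by O(s^(-1/2)), because
   s |Phi(e0)|^2 is bounded. *)
Lemma energy_gap : exists K : R, forall s Phi, 1 <= s ->
  is_harmonic (reweight w e0 s) rho Phi ->
  energy (G := contract_graph a b) w Phihat - energy (reweight w e0 s) Phi
  <= K * Num.sqrt s^-1.
Proof.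
have [w0 _ wact] := hw.
set M := energy _ Phihat.
(* The invariant indicator of the orbit of b. As a lies outside this orbit, subtracting [chi x *: d]
   fixes a and gives b the same image as a. *)
pose chi (x : vert G) : R := if `[< exists g, x = vact G g b >] then 1 else 0.
have chib : chi b = 1 by rewrite /chi asboolT//; exists 0; rewrite zact0.
have chia : chi a = 0.
  rewrite /chi asboolF// => -[g ag]; apply: ab; exists (- g).
  by rewrite ag zactK.
have chiact g x : chi (vact G g x) = chi x.
  rewrite /chi; congr (if _ then _ else _); apply: asbool_equiv_eq.
  split=> -[h hx]; last by exists (g + h); rewrite zactD hx.
  by exists (- g + h); rewrite zactD -hx zactK.
(* The weight of [e0] is set to 0 so that [C] below does not depend on s; the moved map [F] loses no
   energy, as F(e0) = 0. *)
pose w00 := reweight w e0 0.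
have w00_ge0 e : 0 <= w00 e by apply: reweight_ge0.
have := energyZ fin w00 chi.
set C := 2^-1 * _ => hC.
have C0 : 0 <= C.
  rewrite mulr_ge0 ?invr_ge0//; apply: sumr_ge0 => c _.
  by rewrite mulr_ge0 ?sqr_ge0.
(* With r = s^(-1/2), the summand M accounts for the excess r E(Phi) in Young's inequality, and 4 C
   M for the energy of the displacement. *)
exists (M + 4 * C * M) => s Phi s1 hPhi.
have s0 : 0 < s by lra.
set m := energy _ Phi.
have mM : m <= M by exact: harmonic_energy_le.
have ws0 e : 0 <= reweight w e0 s e by apply: reweight_ge0 => //; lra.
have m0 : 0 <= m by exact: energy_ge0.
have qPhi := realization_quasiperiodic hPhi.1.
pose d := edge_vec Phi e0.
have dle : s * sqnorm d <= 2 * M.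
  have := edge_le_energy fin e0 ws0 (reweight_act e0 s wact) qPhi.
  rewrite reweight_same; last exact: same_edge_refl.
  by rewrite -/m -/d; lra.
pose F x := Phi x - chi x *: d.
have hF : is_realization rho F.
  split=> [|g x]; first exact: hPhi.1.1.
  by rewrite /F chiact hPhi.1.2 addrAC.
have Fab : F a = F b.
  rewrite /F chia chib scale0r scale1r subr0 /d /edge_vec orig_e0 term_e0.
  by rewrite opprB addrC subrK.
have F0 : edge_vec F e0 = 0 by rewrite /edge_vec orig_e0 term_e0 Fab subrr.
have MF : M <= energy w00 F.
  rewrite /w00 energy_reweight_null//; first exact: harmonic_contract_le.
  exact: realization_quasiperiodic hF.
have mm : energy w00 Phi <= m.
  apply: ler_energy => // e; rewrite ler_wpM2r ?sqnorm_ge0//.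
  by rewrite /w00 /reweight; case: ifP => // _; exact: ltW.
set r := Num.sqrt s^-1.
have r0 : 0 < r by rewrite sqrtr_gt0 invr_gt0.
have r2 : r ^+ 2 = s^-1 by rewrite sqr_sqrtr// invr_ge0 ltW.
have r1 : r <= 1.
  by rewrite -(@ler_pXn2r _ 2)// ?nnegrE ?(ltW r0)// r2 expr1n invf_le1.
(* The parameter r balances the errors: r E(Phi) and r^-1 |d|^2 are both O(r), because |d|^2 <= 2 M
   r^2. *)
have := energyB_le fin Phi (fun x => chi x *: d) w00_ge0 r0.
rewrite -/F hC => hY.
have dle' : sqnorm d <= 2 * M * r ^+ 2.
  by rewrite r2 -(ler_pM2l s0) mulrCA mulfV ?gt_eqF// mulr1.
have h1 : (1 + r) * energy w00 Phi <= m + r * M.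
  rewrite mulrDl mul1r; apply: lerD => //.
  by rewrite ler_pM2l//; lra.
have h2 : (1 + r^-1) * (sqnorm d * C) <= 4 * C * M * r.
  have ri : 0 < r^-1 by rewrite invr_gt0.
  apply: (@le_trans _ _ ((1 + r^-1) * (2 * M * r ^+ 2 * C))).
    by rewrite ler_wpM2l ?ler_wpM2r// addr_ge0// ltW.
  have -> : (1 + r^-1) * (2 * M * r ^+ 2 * C) = 2 * C * M * (r ^+ 2 + r).
    by field; rewrite gt_eqF.
  have -> : 4 * C * M * r = 2 * C * M * (r + r) by ring.
  apply: ler_wpM2l.
    exact: mulr_ge0 (mulr_ge0 (ler0n _ 2) C0) (le_trans m0 mM).
  by rewrite lerD2r expr2 ger_pMl.
rewrite mulrDl; lra.
Qed.

End Stiff.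
End Contracted.

(** * Convergence of vertices, tension and energy *)

Theorem lemma7p1 (R : realType) (N : nat) (hN : (1 <= N)%N)
    (X : zgraph N) (w : edge X -> R) (hX : is_periodic_graph w)
    (n : nat) (hn : (1 <= n)%N) (v : 'I_n.+1 -> vert X)
    (hv : bijective (fun i => (\pi_(orbits (vact X)) (v i))%qT))
    (e010 : edge X)
    (ho : orig e010 = v (inord 0)) (ht : term e010 = v (inord 1))
    (rho : {additive lattice_group N -> 'cV[R]_N}) (hrho : is_period_hom rho)
    (Phi : R -> vert X -> 'cV[R]_N)
    (hPhi : forall s : R, 0 <= s -> connected_graph (reweight w e010 s) ->
       is_harmonic (reweight w e010 s) rho (Phi s) /\ Phi s (v (inord 0)) = 0)
    (Xhat := contract_graph (v (inord 0)) (v (inord 1)))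
    (proj := contract_pi (v (inord 0)) (v (inord 1)) : vert X -> vert Xhat)
    (Phihat : vert Xhat -> 'cV[R]_N)
    (hPhihat : is_harmonic (G := Xhat) w rho Phihat)
    (hPhihat0 : Phihat (proj (v (inord 0))) = 0) :
  [/\ forall i : 'I_n.+1, (2 <= i)%N ->
        Phi s (v i) @[s --> +oo] --> Phihat (proj (v i)),
      Phi s (v (inord 1)) @[s --> +oo] --> Phihat (proj (v (inord 0))),
      edge_vec (Phi s) e010 @[s --> +oo] --> (0 : 'cV[R]_N),
      tension (reweight w e010 s) (Phi s) @[s --> +oo]
        --> tension (G := Xhat) w Phihat
    & energy (reweight w e010 s) (Phi s) @[s --> +oo]
        --> energy (G := Xhat) w Phihat].
Proof.
have [hw hcon _ _ [_ fin]] := hX.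
have [w0 _ wact] := hw.
(* Since n >= 1, [inord 0] and [inord 1] are distinct indices, so their vertices lie in distinct
   orbits. *)
have hab : ~ exists g, v (inord 1) = vact X g (v (inord 0)).
  move=> /orbits_eqP/(bij_inj hv)/(congr1 val) /=.
  by rewrite !inordK.
pose Psi x := Phihat (proj x).
have hPsi : is_realization rho Psi := realization_contract hPhihat.1.
pose M := energy (G := Xhat) w Phihat.
have [K hK] := energy_gap hw fin ho ht hPhihat hab.
have hs (s : R) : 0 < s -> is_harmonic (reweight w e010 s) rho (Phi s) /\
    Phi s (v (inord 0)) = 0.
  by move=> s0; apply: hPhi; [exact: ltW | exact: connected_reweight].
have hH s (s1 : 1 <= s) := (hs s (lt_le_trans ltr01 s1)).1.
have hH0 s (s1 : 1 <= s) := (hs s (lt_le_trans ltr01 s1)).2.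
(* An edge term is at most twice the energy of Phi(s) - Psi, which is at most 2 (M - m(s)); this
   gives the factor 4. *)
have hedge s e : 1 <= s -> reweight w e010 s e *
    sqnorm (edge_vec (Phi s) e - edge_vec Psi e) <= 4 * K * Num.sqrt s^-1.
  move=> s1; rewrite -edge_vecB.
  have ws0 e' : 0 <= reweight w e010 s e' by apply: reweight_ge0 => //; lra.
  have qp := quasiperiodicB (realization_quasiperiodic (hH s s1).1)
    (realization_quasiperiodic hPsi).
  have := edge_le_energy fin e ws0 (reweight_act e010 s wact) qp.
  have := energy_diff_le fin ho ht hPhihat (hH s s1).
  have := hK s _ s1 (hH s s1).
  rewrite -/Psi -/proj /=; lra.
have cvgK (k : R) : k * Num.sqrt (s^-1 : R) @[s --> +oo] --> (0 : R).
  by rewrite -[X in _ --> X](mulr0 k); apply: cvgMr; exact: cvg_sqrt_inv.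
have cvge e : 0 < w e -> forall i,
    edge_vec (Phi s) e i 0 @[s --> +oo] --> edge_vec Psi e i 0.
  move=> we; apply: sqnorm_cvg_coord.
  (* For s >= 1 this bounds the weight of [e] from below uniformly in s, whether that weight is s or
     [w e]. *)
  pose k := Num.min (w e) 1.
  have k0 : 0 < k by rewrite lt_min we ltr01.
  apply: (squeeze_cvgr _ (cvg_cst 0) (cvgK (k^-1 * (4 * K)))).
  near=> s; have s1 : 1 <= s by [].
  rewrite sqnorm_ge0 /= -mulrA ler_pdivlMl//.
  apply: le_trans (hedge s e s1); apply: ler_wpM2r; first exact: sqnorm_ge0.
  by rewrite /reweight /k; case: ifP => _; rewrite ge_min ?s1 ?lexx ?orbT.
(* The path from v_0 to x consists of edges of positive [w]-weight and serves all s; the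
   normalization at v_0 starts the induction. *)
have cvgx x i : Phi s x i 0 @[s --> +oo] --> Psi x i 0.
  elim: (clos_rt_rtn1 _ _ _ _ (hcon (v (inord 0)) x)) =>
    [|y z [e [oe te we]] _ IH].
    rewrite /Psi hPhihat0; apply/cvgrPdist_lt => eps eps0.
    near=> s; have s1 : 1 <= s by [].
    by rewrite hH0// subrr normr0.
  have split_z (F : vert X -> 'cV[R]_N) : F z i 0 = edge_vec F e i 0 + F y i 0.
    by rewrite /edge_vec oe te !mxE subrK.
  under eq_fun do rewrite split_z.
  by rewrite split_z; apply: cvgD; [exact: cvge | exact: IH].
have vec0 : edge_vec Psi e010 = 0 by exact: contract_edge_vec.
split.
- by move=> i _; apply: cvg_mx => j l; rewrite ord1; exact: cvgx.
- apply: cvg_mx => j l; rewrite ord1 /proj contract_pi_ab; exact: cvgx.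
- rewrite -vec0; apply: cvg_mx => j l; rewrite ord1 /edge_vec.
  by under eq_fun do rewrite !mxE; rewrite !mxE; apply: cvgB; exact: cvgx.
(* By unfolding, [Psi] on [X] has the edge vectors and edge orbits of [Phihat] on [Xhat], so the two
   tensions coincide. *)
- apply: (cvg_tension fin _ (realization_quasiperiodic hPsi) vec0 cvgx).
    by move=> s s0; exact: realization_quasiperiodic (hs s s0).1.1.
  apply: (squeeze_cvgr _ (cvg_cst 0) (cvgK (4 * K))).
  near=> s; have s1 : 1 <= s by [].
  rewrite mulr_ge0 ?sqnorm_ge0 ?(le_trans ler01)//=.
  (* At [e010] the vector of [Psi] vanishes, so [hedge] bounds s |Phi(s)(e010)|^2 itself. *)
  have := hedge s e010 s1; rewrite vec0 subr0 reweight_same//.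
  exact: same_edge_refl.
(* The energy gap gives the lower bound, comparison with [Psi] the upper one. *)
- apply: (@squeeze_cvgr _ _ _ _ (fun s => M - K * Num.sqrt s^-1) (fun=> M)).
  + near=> s; have s1 : 1 <= s by [].
    have := hK s _ s1 (hH s s1).
    have := harmonic_energy_le fin ho ht hPhihat (hH s s1).
    by rewrite -/Xhat -/M => -> /=; rewrite andbT; lra.
  + rewrite -[X in _ --> X](subr0 M).
    by apply: cvgB; [exact: cvg_cst | exact: cvgK].
  + exact: cvg_cst.
Unshelve. all: by end_near. Qed.
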